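(* We have $$\lim_{\alpha \to \pi/2^-} F(\alpha) \ge \sqrt{2}.$$ That is, for every $\varepsilon > 0$ there exists $\delta > 0$ such that for any sufficiently large $d$ there is a set $X \subset \mathbb{R}^d$ of cardinality at least $(\sqrt{2} - \varepsilon)^d$ determining only angles less than $\frac{\pi}{2} - \delta$ (i.e., for any three distinct points $x,y,z \in X$ the angle at $x$ between the vectors $y-x$ and $z-x$ is less than $\frac{\pi}{2}-\delta$).
   Context: For a positive integer $d$ and a real number $\alpha$, $f(d,\alpha)$ denotes the size of the largest set of points in $\mathbb{R}^d$ with no three (distinct) points forming an angle at least $\alpha$; that is, the largest size of a set $X\subset\mathbb{R}^d$ such that for all distinct $x,y,z\in X$ the angle at $x$ between the vectors $y-x$ and $z-x$ is strictly less than $\alpha$. Put $$F(\alpha) := \limsup_{d \to \infty} f(d, \alpha)^{1/d}.$$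
   Formalization: The epsilon-delta form is stated for 0 < ε ≤ √2 only; for larger ε the base √2 − ε is negative and the literal claim fails (e.g. ε = 4, d even, since such a set has at most 2^d points). *)

(* Defs.v *)
From mathcomp Require Import all_boot all_order all_algebra finmap.
From mathcomp Require Import all_classical all_reals all_analysis.
Set Implicit Arguments.
Unset Strict Implicit.
Unset Printing Implicit Defensive.
Import Order.TTheory GRing.Theory Num.Theory.
Import numFieldNormedType.Exports.
Local Open Scope fset_scope.
Local Open Scope classical_set_scope.
Local Open Scope ring_scope.

Definition dotv (R : realType) (d : nat) (u v : 'rV[R]_d) : R :=
  \sum_(i < d) u 0 i * v 0 i.

(* The norm [`|u|] provided by the library on ['rV[R]_d] is the sup norm, hence
   the separate Euclidean norm. *)
Definition enorm (R : realType) (d : nat) (u : 'rV[R]_d) : R :=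
  Num.sqrt (dotv u u).

(* Only meaningful for nonzero [u] and [v]. *)
Definition angle (R : realType) (d : nat) (u v : 'rV[R]_d) : R :=
  acos (dotv u v / (enorm u * enorm v)).

Definition angles_below (R : realType) (d : nat) (alpha : R)
    (X : {fset 'rV[R]_d}) : Prop :=
  forall x y z : 'rV[R]_d, x \in X -> y \in X -> z \in X ->
    x != y -> x != z -> y != z -> angle (y - x) (z - x) < alpha.

(* The largest size is a supremum in the extended reals, so that no finiteness
   proof is needed. Finite sets suffice: the condition passes to subsets, so an
   infinite admissible set makes the supremum [+oo]. *)
Definition max_size (R : realType) (d : nat) (alpha : R) : \bar R :=
  ereal_sup [set (#|` X|%:R)%:E | X in @angles_below R d alpha].

(* The junk value of the root at [d = 0] does not affect the limsup. *)
Definition growth_rate (R : realType) (alpha : R) : \bar R :=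
  limn_esup (fun d : nat => poweR (max_size d alpha) (d%:R^-1)).

(* Main.v *)
(* Call a family of points acute when every angle it determines is less than
   pi/2. The cube {-1,1}^n becomes an acute family in R^(n+1) when each vertex x
   is moved to ((1 - c h_x^2) x, h_x), the heights h_x being tiny and widely
   separated: lifting makes the angle acute at the highest vertex of a right
   triple, and the inward scaling repairs the two other kinds of angles.

   Fix such a family S of 2^(k-1) points in R^k. By the Gilbert bound there is a
   code of about (2^(k-1))^(n/2) words over S, of length n, any two words of
   which agree in slightly less than half of the positions. For three words
   x, y, z a fixed proportion of the positions b then satisfies x_b <> y_b and
   x_b <> z_b; each of these contributes a definite positive amount to
   <y - x, z - x>, and no other position contributes. Hence the cosines are
   bounded away from 0, independently of n, in dimension k n, with about
   (sqrt 2)^(k n) points when k is large. *)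
Require Import Defs.
From mathcomp Require Import all_boot all_order all_algebra finmap.
From mathcomp Require Import all_classical all_reals all_analysis.
From mathcomp Require Import ring lra zify.
Import Order.TTheory GRing.Theory Num.Theory.
Import numFieldNormedType.Exports.
Set Implicit Arguments.
Unset Strict Implicit.
Unset Printing Implicit Defensive.
Local Open Scope ring_scope.

(** * The acute perturbation of the cube *)

Section PerturbedCube.
Variables (R : realType) (n : nat).
Hypothesis n_gt0 : (0 < n)%N.

Let S := {ffun 'I_n -> bool}.
(* The radial scaling has total weight [n * c = 1/8], too small to spoil a
   dominant product of heights; as [tau] is small against [c], it still
   dominates a product of heights in which the largest one occurs only once. *)
Let c : R := (8 * n%:R)^-1.
Let tau : R := c / 8.
(** A separate exponent for each vertex keeps any two heights a factor [tau] apart. *)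
Let h (x : S) : R := tau ^+ (enum_rank x).+1.
Let s (x : S) : R := c * h x ^+ 2.
Let sg (b : bool) : R := (-1) ^+ b.

Definition cube_point (x : S) : 'rV[R]_n.+1 :=
  \row_i (if unlift ord0 i is Some j then (1 - s x) * sg (x j) else h x).

Let term (x y z : S) (j : 'I_n) : R :=
  ((1 - s y) * sg (y j) - (1 - s x) * sg (x j)) *
  ((1 - s z) * sg (z j) - (1 - s x) * sg (x j)).

Let dot_cube_point (x y z : S) :
  dotv (cube_point y - cube_point x) (cube_point z - cube_point x) =
  (h y - h x) * (h z - h x) + \sum_j term x y z j.
Proof.
rewrite /dotv big_ord_recl !mxE unlift_none; congr (_ + _).
by apply: eq_bigr => j _; rewrite !mxE liftK.
Qed.

Let nc : n%:R * c = 8^-1.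
Proof. by rewrite /c; field; rewrite pnatr_eq0 -lt0n. Qed.

Let c_gt0 : 0 < c.
Proof. by rewrite invr_gt0 mulr_gt0 ?ltr0n. Qed.

Let c_le : c <= 8^-1.
Proof. by rewrite -nc ler_peMl ?(ltW c_gt0)// ler1n. Qed.

Let tau_gt0 : 0 < tau. Proof. by rewrite /tau divr_gt0. Qed.

Let tau_le : tau <= 64^-1.
Proof. rewrite /tau; have := c_le; lra. Qed.

Let h_gt0 (x : S) : 0 < h x. Proof. by rewrite exprn_gt0. Qed.

Let h_le (x : S) : h x <= tau.
Proof.
rewrite /h exprS ler_piMr ?(ltW tau_gt0)// exprn_ile1 ?(ltW tau_gt0)//.
have := tau_le; lra.
Qed.

Let h_sep (x y : S) : x != y -> h x <= tau * h y \/ h y <= tau * h x.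
Proof.
move=> xy; have : (enum_rank x != enum_rank y :> nat).
  by apply: contra_neq xy => /val_inj/enum_rank_inj.
have t1 : tau <= 1 by have := tau_le; lra.
rewrite neq_ltn => /orP[] lt; [right|left]; rewrite /h -exprS;
  by apply: ler_wiXn2l => //; rewrite ?(ltW tau_gt0).
Qed.

Let s_ge0 (x : S) : 0 <= s x.
Proof. by rewrite mulr_ge0 ?(ltW c_gt0)// sqr_ge0. Qed.

Let s_bound (x : S) : s x <= c * tau ^+ 2.
Proof.
by rewrite /s ler_pM2l// ler_sqr ?nnegrE ?h_le ?(ltW (h_gt0 _)) ?(ltW tau_gt0).
Qed.

Let s_le_half (x : S) : s x <= 2^-1.
Proof.
apply: (le_trans (s_bound x)).
have : tau ^+ 2 <= 1 by rewrite expr_le1 ?(ltW tau_gt0)//; have := tau_le; lra.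
move=> /(ler_wpM2l (ltW c_gt0)); have := c_le; lra.
Qed.

Let s_sep (x y : S) : h x <= tau * h y -> s x <= tau ^+ 2 * s y.
Proof.
move=> hxy; rewrite /s [leRHS]mulrCA ler_pM2l// -exprMn.
by rewrite ler_sqr// nnegrE ?(ltW (h_gt0 _))// mulr_ge0 ?(ltW (h_gt0 _)) ?(ltW tau_gt0).
Qed.

(** Both factors of [term] contain [- sg (x j)], whose square is 1. What remains for [y] is
    [2 - s x - s y] where the signs differ and [s y - s x] where they agree. *)
Let term_cases (x y z : S) j :
  [\/ [/\ y j != x j, z j != x j & term x y z j = (2 - s x - s y) * (2 - s x - s z)],
      [/\ y j != x j, z j = x j & term x y z j = (2 - s x - s y) * (s z - s x)],
      [/\ y j = x j, z j != x j & term x y z j = (2 - s x - s z) * (s y - s x)] |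
      [/\ y j = x j, z j = x j & term x y z j = (s y - s x) * (s z - s x)]].
Proof.
rewrite /term /sg; case: (x j) (y j) (z j) => [] [] []; rewrite ?expr0 ?expr1.
- by apply: Or44; split => //; ring.
- by apply: Or43; split => //; ring.
- by apply: Or42; split => //; ring.
- by apply: Or41; split => //; ring.
- by apply: Or41; split => //; ring.
- by apply: Or42; split => //; ring.
- by apply: Or43; split => //; ring.
- by apply: Or44; split => //; ring.
Qed.

(** The loss [b] is counted [n] times rather than [n - 1], so that [nc] evaluates the total. *)
Let sum_ge (t : 'I_n -> R) a b j0 : 0 <= b -> a <= t j0 ->
  (forall j, - b <= t j) -> a - n%:R * b <= \sum_j t j.
Proof.
move=> b0 ha hb; rewrite (bigD1 j0)//=.
have -> : a - n%:R * b = (a - b) + (n.-1)%:R * (- b).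
  by rewrite -[in n%:R](prednK n_gt0) -natr1; ring.
apply: lerD; first lra.
have -> : n.-1 = #|predC1 j0| by rewrite cardC1 card_ord.
by rewrite mulr_natl -sumr_const; apply: ler_sum.
Qed.

(** The second alternative is the borderline case: the inner product at [x] vanishes in the
    unperturbed cube. *)
Let disjoint_or (x y z : S) :
  (exists j, y j != x j /\ z j != x j) \/ forall j, y j = x j \/ z j = x j.
Proof.
have [/existsP[j /andP[? ?]]|/existsPn H] :=
  boolP [exists j, (y j != x j) && (z j != x j)]; first by left; exists j.
right => j; have := H j; rewrite negb_and !negbK.
by move=> /orP[] /eqP; [left|right].
Qed.

Let neq_coord (x y : S) : x != y -> exists j, y j != x j.
Proof.
move=> xy; apply/existsP; apply: contraNT xy => /existsPn H.
by apply/eqP/ffunP => j; have := H j; rewrite negbK => /eqP.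
Qed.

(** The common position contributes at least 1, every [s] being at most 1/2; all losses together are
    of order [tau ^+ 2]. *)
Let acute_meet (x y z : S) j : y j != x j -> z j != x j ->
  0 < dotv (cube_point y - cube_point x) (cube_point z - cube_point x).
Proof.
move=> yx zx; rewrite dot_cube_point.
have tge : 1 <= term x y z j.
  case: (term_cases x y z j) => [[_ _ ->]|[_ E]|[E]|[E]]; rewrite ?E ?eqxx// in yx zx *.
  have := s_le_half x; have := s_le_half y; have := s_le_half z => *; nra.
have tau2 : 0 <= c * tau ^+ 2 by rewrite mulr_ge0 ?(ltW c_gt0) ?sqr_ge0.
have := @sum_ge (term x y z) 1 (2 * (c * tau ^+ 2)) j.
have -> : n%:R * (2 * (c * tau ^+ 2)) = tau ^+ 2 / 4.
  by transitivity (2 * (n%:R * c) * tau ^+ 2); [ring|rewrite nc; field].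
have lo : forall j', - (2 * (c * tau ^+ 2)) <= term x y z j'.
  move=> j'; have := s_le_half x; have := s_le_half y; have := s_le_half z.
  have := s_ge0 x; have := s_ge0 y; have := s_ge0 z.
  have := s_bound x; have := s_bound y; have := s_bound z => *.
  by case: (term_cases x y z j') => [[_ _ ->]|[_ _ ->]|[_ _ ->]|[_ _ ->]]; nra.
move=> /(_ _ tge lo) H; have {}H := H ltac:(lra).
have := h_gt0 x; have := h_gt0 y; have := h_gt0 z.
have := h_le x; have := h_le y; have := h_le z.
have := tau_le; have := tau_gt0 => *.
have : - tau ^+ 2 <= (h y - h x) * (h z - h x) by nra.
nra.
Qed.

(* The highest point is at the vertex of the angle: the product of heights wins. *)
Let acute_apex (x y z : S) : (forall j, y j = x j \/ z j = x j) ->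
  h y <= tau * h x -> h z <= tau * h x ->
  0 < dotv (cube_point y - cube_point x) (cube_point z - cube_point x).
Proof.
move=> dis yx zx; rewrite dot_cube_point.
have lo : forall j, - (2 * s x) <= term x y z j.
  move=> j; have := s_le_half x; have := s_le_half y; have := s_le_half z.
  have := s_ge0 x; have := s_ge0 y; have := s_ge0 z.
  have := s_sep yx; have := s_sep zx.
  have : tau ^+ 2 <= 1 by rewrite expr_le1 ?(ltW tau_gt0)//; have := tau_le; lra.
  move=> t1 z2 y2 ? ? ? ? ? ?.
  have {}z2 : s z <= s x by nra.
  have {}y2 : s y <= s x by nra.
  case: (term_cases x y z j) => [[A B _]|[_ _ ->]|[_ _ ->]|[_ _ ->]]; try nra.
  by case: (dis j) => E; rewrite E eqxx in A B.
have H := sum_ge _ (lo (Ordinal n_gt0)) lo.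
have {}H := H ltac:(by rewrite mulr_ge0).
have E : n%:R * (2 * s x) = h x ^+ 2 / 4.
  by transitivity (2 * (n%:R * c) * h x ^+ 2); [rewrite /s; ring|rewrite nc; field].
have E2 : 2 * s x = 2 * c * h x ^+ 2 by rewrite /s mulrA.
rewrite E E2 in H.
have := h_gt0 x; have := h_gt0 y; have := h_gt0 z.
have := tau_le; have := tau_gt0; have := c_le => *.
have ? : h y <= h x / 64 by nra.
have ? : h z <= h x / 64 by nra.
(* The gain, 9/16 of [h x ^+ 2], beats the two losses, each at most a quarter of it. *)
have : (h x * (3/4)) * (h x * (3/4)) <= (h y - h x) * (h z - h x) by nra.
have : 2 * c * h x ^+ 2 <= h x ^+ 2 / 4 by nra.
have : 0 < h x ^+ 2 by rewrite exprn_gt0.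
nra.
Qed.

(* The highest point is [y]: the scaling wins, through a position where [z]
   differs from [x]. *)
Let acute_side (x y z : S) : (forall j, y j = x j \/ z j = x j) -> x != z ->
  h x <= tau * h y -> h z <= tau * h y ->
  0 < dotv (cube_point y - cube_point x) (cube_point z - cube_point x).
Proof.
move=> dis /neq_coord[j0 zx0] xy zy; rewrite dot_cube_point.
have t2 : tau ^+ 2 <= 64^-1.
  by have := tau_le; have := tau_gt0 => *; rewrite expr2; nra.
have sxy := s_sep xy; have szy := s_sep zy.
have [sx sy sz] := And3 (s_le_half x) (s_le_half y) (s_le_half z).
have [sx0 sy0 sz0] := And3 (s_ge0 x) (s_ge0 y) (s_ge0 z).
have lo : forall j, - (2 * (tau ^+ 2 * s y)) <= term x y z j.
  move=> j; set b := tau ^+ 2 * s y in sxy szy *.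
  have sxy' : s x <= s y by rewrite /b in sxy; nra.
  case: (term_cases x y z j) => [[A B _]|[_ _ ->]|[_ _ ->]|[_ _ ->]]; try nra.
  by case: (dis j) => E; rewrite E eqxx in A B.
(* At [j0] only [z] differs from [x], so the term is [(2 - s x - s z) * (s y - s x)], with first
   factor at least 1. *)
have hi : s y - tau ^+ 2 * s y <= term x y z j0.
  have yx0 : y j0 = x j0 by case: (dis j0) => // E; rewrite E eqxx in zx0.
  case: (term_cases x y z j0) => [[A _ _]|[A _ _]|[_ _ ->]|[_ B _]].
  - by rewrite yx0 eqxx in A.
  - by rewrite yx0 eqxx in A.
  - have ? : s x <= s y by nra.
    nra.
  - by rewrite B eqxx in zx0.
have H := sum_ge _ hi lo.
have {}H := H ltac:(by rewrite mulr_ge0// (mulr_ge0 (sqr_ge0 _) (s_ge0 y))).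
have E : n%:R * (2 * (tau ^+ 2 * s y)) = tau * c * h y ^+ 2 / 32.
  transitivity (2 * (n%:R * c) * tau * tau * h y ^+ 2); first by rewrite /s; ring.
  by rewrite nc /tau; field.
rewrite E in H.
have := h_gt0 x; have := h_gt0 y; have := h_gt0 z.
have := tau_le; have := tau_gt0; have := c_le => *.
have lh : - (tau * h y ^+ 2) <= (h y - h x) * (h z - h x).
  have ? : h x <= h y by nra.
  have ? : 0 <= (h y - h x) * h z by rewrite mulr_ge0 ?subr_ge0// ltW.
  have ? : (h y - h x) * h x <= h y * (tau * h y) by apply: ler_pM; lra.
  nra.
have hy2 : 0 < h y ^+ 2 by rewrite exprn_gt0.
(* With [tau = c / 8] the possible loss from the heights is an eighth of [s y]. *)
have Et : tau * h y ^+ 2 = s y / 8 by rewrite /tau /s; field.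
have : tau * c * h y ^+ 2 / 32 <= s y / 8.
  rewrite -Et.
  rewrite (_ : _ / 32 = tau * h y ^+ 2 * (c / 32)); last by ring.
  by rewrite ler_piMr ?(mulr_ge0 (ltW tau_gt0) (ltW hy2))//; lra.
have : 0 < s y by rewrite mulr_gt0.
rewrite Et in lh.
nra.
Qed.

Let dotvC d (u v : 'rV[R]_d) : dotv u v = dotv v u.
Proof. by apply: eq_bigr => i _; rewrite mulrC. Qed.

(** If no position separates [x] from both others, the three vertices are distinct and the highest
    one decides. The case [y = z] is included and later yields injectivity. *)
Lemma cube_point_acute (x y z : S) : y != x -> z != x ->
  0 < dotv (cube_point y - cube_point x) (cube_point z - cube_point x).
Proof.
move=> yx zx; case: (disjoint_or x y z) => [[j [A B]]|dis]; first exact: acute_meet A B.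
have dis' j : z j = x j \/ y j = x j by case: (dis j); [right|left].
have yz : y != z.
  apply/eqP => E; move: zx; rewrite eq_sym => /neq_coord[j].
  by case: (dis j) => Ej; rewrite -?E ?Ej ?eqxx// E Ej eqxx.
have step u v w : h u <= tau * h v -> h v <= tau * h w -> h u <= tau * h w.
  move=> uv vw; apply: (le_trans uv); rewrite ler_pM2l//.
  apply: (le_trans vw); rewrite ler_piMl ?(ltW (h_gt0 _))//.
  by have := tau_le; lra.
have xy : x != y by rewrite eq_sym.
have xz : x != z by rewrite eq_sym.
have side' : h x <= tau * h z -> h y <= tau * h z ->
    0 < dotv (cube_point y - cube_point x) (cube_point z - cube_point x).
  by move=> *; rewrite dotvC; apply: acute_side.
(* Two of the eight combinations are cyclic; they are not refuted, since transitivity supplies the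
   comparison required. *)
case: (h_sep xy) => A; case: (h_sep xz) => B; case: (h_sep yz) => C.
- exact: side'.
- exact: acute_side.
- by apply: side' => //; apply: step C.
- by apply: acute_side => //; apply: step B A.
- by apply: side' => //; apply: step A B.
- by apply: acute_side => //; apply: step C.
- exact: acute_apex.
- exact: acute_apex.
Qed.

End PerturbedCube.

(** * Gilbert codes: many words with few pairwise agreements *)

Section Code.
Variables (S : finType) (n : nat).
Implicit Types (x y w : {ffun 'I_n -> S}).

Definition agreement x y : {set 'I_n} := [set i | x i == y i]%SET.

Lemma card_extensions x (T : {set 'I_n}) :
  (#|[set w | T \subset agreement w x]%SET| <= #|S| ^ (n - #|T|))%N.
Proof.
pose F i : pred S := if i \in T then pred1 (x i) else predT.
have sub : [set w | T \subset agreement w x]%SET \subset [pred w in family F].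
  apply/fintype.subsetP => w; rewrite !inE => /fintype.subsetP Tw; apply/familyP => i.
  rewrite /F; case: ifP => // iT; have := Tw i iT; by rewrite !inE.
apply: (leq_trans (subset_leq_card sub)).
rewrite card_family foldrE big_map big_enum /=.
rewrite (eq_bigr (fun i => if i \notin T then #|S| else 1)%N); last first.
  by move=> i _; rewrite /F; case: (i \in T); rewrite ?card1.
rewrite -big_mkcond/= (eq_bigl (mem (~: T)%SET)); last by move=> i; rewrite !inE.
by rewrite prod_nat_const cardsCs finset.setCK card_ord.
Qed.

Lemma card_bigcup_le (I T : finType) (P : pred I) (F : I -> {set T}) :
  (#|\bigcup_(i | P i) F i|%SET <= \sum_(i | P i) #|F i|)%N.
Proof.
elim/big_rec2: _ => [|i k A _ leA]; first by rewrite cards0.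
by rewrite (leq_trans (leq_card_setU _ _))// leq_add2l.
Qed.

(** Union bound over the possible agreement sets [T], at most [2 ^ n] of them. This crude factor is
    affordable because the alphabet will be large. *)
Lemma card_agreement_ball x t : (0 < #|S|)%N ->
  (#|[set w | (t <= #|agreement w x|)%N]%SET| <= 2 ^ n * #|S| ^ (n - t))%N.
Proof.
move=> S_gt0.
have sub : [set w | (t <= #|agreement w x|)%N]%SET \subset
    (\bigcup_(T : {set 'I_n} | (t <= #|T|)%N) [set w | T \subset agreement w x])%SET.
  apply/fintype.subsetP => w; rewrite inE => tw.
  by apply/finset.bigcupP; exists (agreement w x); rewrite // inE.
apply: (leq_trans (subset_leq_card sub)); apply: (leq_trans (card_bigcup_le _ _)).
have -> : (2 ^ n)%N = #|{set 'I_n}| by rewrite -cardsT -powersetT card_powerset cardsT card_ord.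
rewrite -sum_nat_const big_mkcond/=; apply: leq_sum => T _; case: ifP => // tT.
by rewrite (leq_trans (card_extensions _ _))// leq_pexp2l// leq_sub2l.
Qed.

(** A maximal code works: a word agreeing with each codeword in fewer than [t] positions could be
    added, so the agreement balls around the codewords cover all words. *)
Lemma gilbert_code t : (0 < #|S|)%N -> (t <= n)%N ->
  exists2 X : {set {ffun 'I_n -> S}},
    {in X &, forall x y, x != y -> (#|agreement x y| < t)%N} &
    (#|S| ^ t <= #|X| * 2 ^ n)%N.
Proof.
move=> S_gt0 tn.
pose sep (X : {set {ffun 'I_n -> S}}) :=
  [forall x in X, forall y in X, (x != y) ==> (#|agreement x y| < t)%N].
have sepP (X : {set {ffun 'I_n -> S}}) :
  reflect {in X &, forall x y, x != y -> (#|agreement x y| < t)%N} (sep X).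
  apply: (iffP idP) => [/forall_inP H x y xX yX|H].
    by have /forall_inP/(_ y yX)/implyP := H x xX.
  by apply/forall_inP => x xX; apply/forall_inP => y yX; apply/implyP; apply: H.
have [|X /maxsetP[/sepP sX maxX]] := @ex_maxset _ sep.
  by exists finset.set0; apply/sepP => x y; rewrite inE.
exists X => //.
have agreeC x y : agreement x y = agreement y x.
  by apply/setP => i; rewrite !inE eq_sym.
have cover : [set: {ffun 'I_n -> S}]%SET \subset
    (\bigcup_(x in X) [set w | (t <= #|agreement w x|)%N])%SET.
  apply/fintype.subsetP => w _; apply/finset.bigcupP.
  have [wX|wX] := boolP (w \in X).
    exists w => //; rewrite inE (_ : agreement w w = finset.setT) ?cardsT ?card_ord//.
    by apply/setP => i; rewrite !inE eqxx.
  apply/exists_inP; apply: contraNT wX; rewrite negb_exists_in => /forall_inP far.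
  have farw x : x \in X -> (#|agreement w x| < t)%N.
    by move=> /far; rewrite inE -ltnNge.
  suff <- : (w |: X)%SET = X by rewrite finset.setU11.
  apply: maxX; last exact: finset.subsetUr.
  apply/sepP => x y; rewrite !inE => /orP[/eqP->|xX] /orP[/eqP->|yX] xy.
  - by rewrite eqxx in xy.
  - exact: farw.
  - by rewrite agreeC farw.
  - exact: sX.
have := leq_trans (subset_leq_card cover) (card_bigcup_le _ _).
rewrite cardsT card_ffun card_ord => H.
have {}H : (#|S| ^ n <= #|X| * (2 ^ n * #|S| ^ (n - t)))%N.
  apply: (leq_trans H); rewrite -sum_nat_const; apply: leq_sum => x _.
  exact: card_agreement_ball.
rewrite -(@leq_pmul2r (#|S| ^ (n - t))) ?expn_gt0 ?S_gt0//.
by rewrite -expnD subnKC// -mulnA.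
Qed.

End Code.

(** * Concatenation of blocks *)

Section BlockProduct.
Variables (R : realType) (S : finType) (k : nat) (P : S -> 'rV[R]_k).

Hypothesis k_gt0 : (0 < k)%N.

Let coord (x : S) (j : nat) : R := if insub j is Some i then P x 0 i else 0.

(** Padding with 0 from coordinate [n * k] on serves every [d >= n * k], not only the multiples of
    [k]. *)
Definition block_point n d (w : {ffun 'I_n -> S}) : 'rV[R]_d :=
  \row_i (if insub (i %/ k)%N is Some b then coord (w b) (i %% k) else 0).

Lemma dotv_block_point n d (x y z : {ffun 'I_n -> S}) : (n * k <= d)%N ->
  dotv (block_point d y - block_point d x) (block_point d z - block_point d x) =
  \sum_b dotv (P (y b) - P (x b)) (P (z b) - P (x b)).
Proof.
move=> nkd.
pose v (w : {ffun 'I_n -> S}) i : R :=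
  if insub (i %/ k)%N is Some b then coord (w b) (i %% k) else 0.
transitivity (\sum_(0 <= i < d) (v y i - v x i) * (v z i - v x i)).
  by rewrite big_mkord; apply: eq_bigr => i _; rewrite !mxE.
rewrite (big_cat_nat _ nkd)//= [X in _ + X]big_nat_cond [X in _ + X]big1 ?addr0; last first.
  move=> i; rewrite andbT => /andP[ni id].
  rewrite /v insubF ?subrr ?mul0r//; apply/negbTE; rewrite -leqNgt.
  by rewrite leq_divRL.
rewrite big_nat_mul big_mkord; apply: eq_bigr => b _.
rewrite mulSn (addnC k) -{1}[(b * k)%N]add0n big_addn addKn big_mkord.
apply: eq_bigr => j _; rewrite !mxE /v.
rewrite addnC divnMDl// modnMDl divn_small// addn0 modn_small// valK.
by rewrite /coord valK.
Qed.

End BlockProduct.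

(** * Angle bounds that are uniform in the length of the words *)

Section Angles.
Variable R : realType.

Lemma dotv_ge0 d (u : 'rV[R]_d) : 0 <= dotv u u.
Proof. by apply: sumr_ge0 => i _; rewrite -expr2 sqr_ge0. Qed.

Lemma dotv_cauchy_schwarz d (u v : 'rV[R]_d) :
  dotv u v ^+ 2 <= dotv u u * dotv v v.
Proof.
have key (a b : R) : 0 <= a ^+ 2 * dotv u u - 2 * (a * b) * dotv u v + b ^+ 2 * dotv v v.
  have -> : a ^+ 2 * dotv u u - 2 * (a * b) * dotv u v + b ^+ 2 * dotv v v =
      \sum_i (a * u 0 i - b * v 0 i) ^+ 2.
    rewrite /dotv !mulr_sumr -sumrN -!big_split/=.
    by apply: eq_bigr => i _; ring.
  by apply: sumr_ge0 => i _; rewrite sqr_ge0.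
(* With the abbreviations below, [(V, W)] and [(W, U)] give [V * (U * V - W ^+ 2) >= 0] and the same
   with [U] in front; [(1, W)] settles [U = V = 0]. *)
have := key (dotv v v) (dotv u v); have := key (dotv u v) (dotv u u).
have := key 1 (dotv u v); have := dotv_ge0 u; have := dotv_ge0 v.
set U := dotv u u; set V := dotv v v; set W := dotv u v => V0 U0 k3 k2 k1.
have [V1|V1] := ltP 0 V; first by rewrite -subr_ge0 -(pmulr_rge0 _ V1); lra.
have [U1|U1] := ltP 0 U; first by rewrite -subr_ge0 -(pmulr_rge0 _ U1); lra.
have {V1}V1 : V = 0 by apply/eqP; rewrite eq_le V1 V0.
have {U1}U1 : U = 0 by apply/eqP; rewrite eq_le U1 U0.
by rewrite V1 U1 in k3 *; lra.
Qed.

Lemma acos_le (a b : R) : -1 <= a -> a <= b -> b <= 1 -> acos b <= acos a.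
Proof.
move=> a1 ab b1.
have [/[!in_itv]/= Ia Ib] : acos a \in `[0, pi] /\ acos b \in `[0, pi].
  by rewrite !in_itv/= !acos_ge0 ?acos_lepi//; lra.
have aK : cos (acos a) = a by rewrite acosK// in_itv/=; lra.
have bK : cos (acos b) = b by rewrite acosK// in_itv/=; lra.
rewrite leNgt; apply/negP; rewrite -ltr_cos ?in_itv//= aK bK; lra.
Qed.

Lemma acos_lt_pihalf (a : R) : 0 < a -> a <= 1 -> acos a < pi / 2.
Proof.
move=> a0 a1; have := acos_le (lerN10 R) (ltW a0) a1.
have aK : cos (acos a) = a by rewrite acosK// in_itv/=; lra.
have zK : cos (acos 0) = 0 :> R by rewrite acosK// in_itv/= lerN10 ler01.
rewrite -acos0 le_eqVlt => /orP[/eqP E|//].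
by have az : a = 0 by [rewrite -aK E zK]; rewrite az ltxx in a0.
Qed.

(** Both norms are at most the square root of [L], so the cosine is at least [kappa]. Cauchy-Schwarz
    bounds it by 1, which keeps [acos] on its domain. *)
Lemma angle_le_acos d (u v : 'rV[R]_d) (kappa L : R) : 0 < kappa -> 0 < L ->
  dotv u u <= L -> dotv v v <= L -> kappa * L <= dotv u v ->
  kappa <= 1 /\ angle u v <= acos kappa.
Proof.
move=> k0 L0 uL vL kL; have kL0 := mulr_gt0 k0 L0.
have w0 : 0 < dotv u v by lra.
have cs := dotv_cauchy_schwarz u v.
have [u0 v0] : 0 < dotv u u /\ 0 < dotv v v.
  have := dotv_ge0 u; have := dotv_ge0 v; rewrite 2!le_eqVlt.
  have sq : 0 < dotv u v ^+ 2 by rewrite exprn_gt0.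
  case/orP => [/eqP E|->]; first by rewrite -E mulr0 in cs; lra.
  case/orP => [/eqP E|->//]; by rewrite -E mul0r in cs; lra.
have uv0 : 0 < enorm u * enorm v by rewrite mulr_gt0// sqrtr_gt0.
have uvE : enorm u * enorm v = Num.sqrt (dotv u u * dotv v v).
  by rewrite sqrtrM ?(ltW u0).
have uvL : enorm u * enorm v <= L.
  rewrite uvE -(ger0_norm (ltW L0)) -sqrtr_sqr; apply: ler_wsqrtr.
  by rewrite expr2; apply: ler_pM; rewrite ?(ltW u0) ?(ltW v0).
have c1 : dotv u v / (enorm u * enorm v) <= 1.
  rewrite ler_pdivrMr// mul1r uvE -[leLHS](ger0_norm (ltW w0)) -sqrtr_sqr.
  by rewrite ler_wsqrtr.
have kc : kappa <= dotv u v / (enorm u * enorm v).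
  by rewrite ler_pdivlMr// (le_trans _ kL)// ler_pM2l.
split; first exact: le_trans c1.
by apply: acos_le => //; lra.
Qed.

Lemma fin_pos_lbound (T : finType) (Q : pred T) (f : T -> R) :
  (forall t, Q t -> 0 < f t) -> exists2 c : R, 0 < c & forall t, Q t -> c <= f t.
Proof.
move=> f0; have S0 : 0 <= \sum_(t | Q t) (f t)^-1.
  by apply: sumr_ge0 => t /f0/ltW; rewrite invr_ge0.
(* This replaces a minimum and makes sense even when no [t] satisfies [Q]. *)
exists (1 + \sum_(t | Q t) (f t)^-1)^-1; first by rewrite invr_gt0; lra.
move=> t Qt; rewrite -[leRHS]invrK lef_pV2 ?posrE ?invr_gt0 ?f0//; last lra.
rewrite (bigD1 t)//=.
suff : 0 <= \sum_(i | Q i && (i != t)) (f i)^-1 by lra.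
by apply: sumr_ge0 => i /andP[/f0/ltW]; rewrite invr_ge0.
Qed.

Lemma fin_ubound (T : finType) (f : T -> R) :
  exists2 C : R, 0 < C & forall t, f t <= C.
Proof.
have S0 : 0 <= \sum_t `|f t| by apply: sumr_ge0.
exists (1 + \sum_t `|f t|); first lra.
move=> t; rewrite (bigD1 t)//=.
have : 0 <= \sum_(i | i != t) `|f i| by apply: sumr_ge0.
by have := ler_norm (f t); lra.
Qed.

(** At least [n / r] blocks contribute [c] or more and the others 0, while squared lengths are at
    most [n * C]; so [n] cancels and [c / (r * C)] bounds the cosine. *)
Lemma block_point_angle (S : finType) (k : nat) (P : S -> 'rV[R]_k) (r : nat) :
  (0 < k)%N -> (0 < r)%N ->
  (forall x y z, y != x -> z != x -> 0 < dotv (P y - P x) (P z - P x)) ->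
  exists2 kappa : R, 0 < kappa &
    forall n d (x y z : {ffun 'I_n -> S}), (0 < n)%N -> (n * k <= d)%N ->
      (n <= r * #|[set b | (y b != x b) && (z b != x b)]%SET|)%N ->
      kappa <= 1 /\
      angle (block_point P d y - block_point P d x)
            (block_point P d z - block_point P d x) <= acos kappa.
Proof.
move=> k0 r0 acute.
have [c c0 clow] := @fin_pos_lbound (S * S * S)%type
  (fun t => (t.1.2 != t.1.1) && (t.2 != t.1.1))
  (fun t => dotv (P t.1.2 - P t.1.1) (P t.2 - P t.1.1))
  (fun t H => acute _ _ _ (proj1 (andP H)) (proj2 (andP H))).
have [C C0 Cup] := @fin_ubound (S * S)%type
  (fun t => dotv (P t.2 - P t.1) (P t.2 - P t.1)).
have rC0 : 0 < r%:R * C by rewrite mulr_gt0 ?ltr0n.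
exists (c / (r%:R * C)); first by rewrite divr_gt0.
move=> n d x y z n0 nkd nr.
have up (w : {ffun 'I_n -> S}) : dotv (block_point P d w - block_point P d x)
    (block_point P d w - block_point P d x) <= n%:R * C.
  rewrite dotv_block_point// mulr_natl -[in leRHS](card_ord n) -sumr_const.
  by apply: ler_sum => b _; exact: (Cup (x b, w b)).
apply: (@angle_le_acos _ _ _ _ (n%:R * C)) => //.
- by rewrite divr_gt0.
- by rewrite mulr_gt0 ?ltr0n.
rewrite dotv_block_point//; set G := [set b | _]%SET in nr.
have -> : c / (r%:R * C) * (n%:R * C) = (n%:R / r%:R) * c.
  by field; rewrite !gt_eqF ?ltr0n.
apply: (@le_trans _ _ (#|G|%:R * c)).
  by rewrite ler_pM2r// ler_pdivrMr ?ltr0n// -natrM ler_nat mulnC.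
rewrite mulr_natl -sumr_const [leLHS]big_mkcond/=; apply: ler_sum => b _.
rewrite inE; case: ifPn => [H|]; first exact: (clow (x b, y b, z b) H).
by rewrite negb_and !negbK => /orP[]/eqP->; rewrite subrr /dotv big1// => i _;
  rewrite !mxE ?mul0r ?mulr0.
Qed.

End Angles.

(** * Choice of parameters and the sets in high dimension *)

Lemma card_good_coords (S : finType) n t (x y z : {ffun 'I_n -> S}) :
  (#|agreement x y| < t)%N -> (#|agreement x z| < t)%N ->
  (n <= #|[set b | (y b != x b) && (z b != x b)]%SET| + 2 * t)%N.
Proof.
move=> xy xz; set G := [set b | _]%SET.
have GC : (~: G = agreement x y :|: agreement x z)%SET.
  by apply/setP => b; rewrite !inE negb_and !negbK !(eq_sym (x b)).
rewrite -[leqLHS](card_ord n) -(cardsC G) leq_add2l GC.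
by rewrite (leq_trans (leq_card_setU _ _))// mul2n -addnn leq_add// ltnW.
Qed.

Lemma block_point_inj (R : realType) (S : finType) k (P : S -> 'rV[R]_k) n d :
  (0 < k)%N -> (n * k <= d)%N ->
  (forall x y, y != x -> 0 < dotv (P y - P x) (P y - P x)) ->
  injective (@block_point R S k P n d).
Proof.
move=> k0 nkd dist x y xy; apply/eqP; apply: contraT => /eqP/ffunP H.
have /forallPn[b xyb] : ~~ [forall b, x b == y b].
  by apply/negP => /forallP E; apply: H => b; apply/eqP.
have := dotv_block_point P k0 x y y nkd; rewrite xy subrr.
rewrite [LHS]big1; last by move=> i _; rewrite mxE mul0r.
rewrite (bigD1 b)//= => E.
have := dist (x b) (y b); rewrite eq_sym => /(_ xyb).
have : 0 <= \sum_(i | i != b) dotv (P (y i) - P (x i)) (P (y i) - P (x i)).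
  by apply: sumr_ge0 => i _; exact: dotv_ge0.
by move: E; lra.
Qed.

(* The last hypothesis is [gilbert_code] for [2 ^ k.-1] letters, length
   [2 * k * q] and agreements smaller than [k.-1 * q]. *)
Lemma exp_growth_bound (R : realType) (eps : R) :
  0 < eps -> eps <= Num.sqrt 2 ->
  exists2 k, (1 < k)%N & forall q d M, (k <= q)%N ->
    (2 * k ^ 2 * q <= d <= 2 * k ^ 2 * q.+1)%N ->
    (2 ^ (k.-1 ^ 2 * q) <= M * 2 ^ (2 * k * q))%N ->
    (Num.sqrt 2 - eps) ^+ d <= M%:R.
Proof.
move=> e0 e2; have s20 : 0 < Num.sqrt 2 :> R by rewrite sqrtr_gt0.
pose rho := 1 - eps / Num.sqrt 2.
have rho0 : 0 <= rho by rewrite subr_ge0 ler_pdivrMr// mul1r.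
have rho1 : rho < 1 by rewrite ltrBlDr ltrDl divr_gt0.
have sqE : Num.sqrt 2 - eps = Num.sqrt 2 * rho.
  by rewrite /rho mulrBr mulr1 mulrCA divff ?mulr1// gt_eqF.
(* As [d >= 2 * k ^ 2 * q], the bound 1/8 gives a factor [2 ^- (6 * k * q)]: [2 * k * q] pays for
   the factor next to [M], and [4 * k * q] for passing from [k.-1 ^ 2 * q] to [k ^ 2 * q.+1]. *)
have [k k1 rhok] : exists2 k, (1 < k)%N & rho ^+ k <= 2 ^- 3.
  have /cvgrPdist_lt/(_ (2 ^- 3)) : (rho ^+ m @[m --> \oo] --> 0)%classic.
    by apply: cvg_expr; rewrite ger0_norm.
  rewrite invr_gt0 exprn_gt0// => /(_ isT)[m _ mP].
  exists (m + 2)%N; first lia.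
  have := mP (m + 2)%N; rewrite /= leq_addr => /(_ isT).
  by rewrite sub0r normrN ger0_norm ?exprn_ge0// => /ltW.
exists k => // q d M kq /andP[dlo dhi] HM.
have rho1' := ltW rho1.
have rhod : rho ^+ d <= 2 ^- (6 * k * q).
  apply: (@le_trans _ _ (rho ^+ (2 * k ^ 2 * q))); first exact: ler_wiXn2l.
  rewrite (_ : (2 * k ^ 2 * q = k * (2 * k * q))%N); last by lia.
  rewrite (_ : (6 * k * q = 3 * (2 * k * q))%N); last by lia.
  rewrite (exprM _ k) (exprM _ 3) -[leRHS]exprVn.
  apply: lerXn2r => //; first by rewrite nnegrE exprn_ge0.
  by rewrite nnegrE invr_ge0 exprn_ge0.
have sqd : Num.sqrt 2 ^+ d <= 2 ^+ (k ^ 2 * q.+1) :> R.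
  apply: (@le_trans _ _ (Num.sqrt 2 ^+ (2 * k ^ 2 * q.+1))).
    by apply: ler_weXn2l => //; rewrite -[leLHS]sqrtr1 ler_wsqrtr// ler1n.
  by rewrite -mulnA exprM sqr_sqrtr.
rewrite sqE exprMn.
apply: (@le_trans _ _ (2 ^+ (k ^ 2 * q.+1) * 2 ^- (6 * k * q))).
  by apply: ler_pM => //; rewrite exprn_ge0// ltW.
rewrite ler_pdivrMr ?exprn_gt0// -!natrX -natrM ler_nat.
have expo : (k ^ 2 * q.+1 <= k.-1 ^ 2 * q + 4 * k * q)%N.
  by case: k {rhok dlo dhi HM rhod sqd} k1 kq => // k _ kq /=; nia.
apply: (leq_trans (leq_pexp2l _ expo)) => //.
rewrite expnD (_ : (6 * k * q = 2 * k * q + 4 * k * q)%N); last by rewrite -!mulnA -mulnDl.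
by rewrite expnD mulnA leq_pmul2r ?expn_gt0.
Qed.

Lemma large_angles_below (R : realType) (eps : R) : 0 < eps -> eps <= Num.sqrt 2 ->
  exists2 delta : R, 0 < delta &
    exists N : nat, forall d : nat, (N <= d)%N ->
      exists X : {fset 'rV[R]_d},
        (Num.sqrt 2 - eps) ^+ d <= #|` X|%:R /\
        angles_below (pi / 2 - delta) X.
Proof.
move=> e0 e2; have [[//|k] k1 growth] := exp_growth_bound e0 e2.
(* From here the block length is [k.+1] and the cube has dimension [k]; [k1] unfolds to [0 < k]. *)
have acute := @cube_point_acute R k k1.
have [kappa kappa0 angleP] :=
  @block_point_angle R _ _ (@cube_point R k) k.+1 isT isT acute.
(* [kappa <= 1] is known only once suitable words are given, so the minimum keeps [acos] on its
   domain; halving the gap makes the final inequality strict. *)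
exists ((pi / 2 - acos (Num.min 1 kappa)) / 2).
  have := @acos_lt_pihalf R (Num.min 1 kappa).
  rewrite lt_min ltr01 kappa0 ge_min lexx => /(_ isT isT); lra.
exists (2 * k.+1 ^ 2 * k.+1)%N => d Nd.
pose q := (d %/ (2 * k.+1 ^ 2))%N.
have kk0 : (0 < 2 * k.+1 ^ 2)%N by rewrite muln_gt0 expn_gt0.
have kq : (k.+1 <= q)%N by rewrite leq_divRL// mulnC.
have dlo : (2 * k.+1 ^ 2 * q <= d)%N by rewrite mulnC leq_divM.
have dhi : (d <= 2 * k.+1 ^ 2 * q.+1)%N by rewrite mulnC ltnW// ltn_ceil.
(* Two agreement sets smaller than [k * q] leave at least [n - 2 * k * q = 2 * q] positions, a
   fraction [1 / k.+1] of [n]; hence the ratio [k.+1] above. *)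
pose n := (2 * k.+1 * q)%N; pose S := {ffun 'I_k -> bool}.
have cS : #|{: S}| = (2 ^ k)%N by rewrite card_ffun card_bool card_ord.
have [|X sepX] := @gilbert_code S n (k * q) _ ltac:(by rewrite /n; lia).
  by rewrite cS expn_gt0.
rewrite cS -expnM (_ : (k * (k * q) = k.+1.-1 ^ 2 * q)%N); last by rewrite /=; lia.
move=> cX.
have nkd : (n * k.+1 <= d)%N by apply: leq_trans dlo; rewrite /n; lia.
have inj : injective (@block_point R S _ (@cube_point R k) n d).
  by apply: block_point_inj => // x y yx; apply: acute.
exists [fset block_point (@cube_point R k) d w | w in X]%fset; split.
  rewrite card_imfset//= -cardE; apply: growth cX => //; first by rewrite dlo.
move=> _ _ _ /imfsetP[/= x xX ->] /imfsetP[/= y yX ->] /imfsetP[/= z zX ->].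
rewrite !(inj_eq inj) => xy xz yz.
have n0 : (0 < n)%N by rewrite !muln_gt0/= (leq_trans _ kq).
have /(_ _)/= [|kle angle_le] := angleP n d x y z n0 nkd.
  have := card_good_coords (sepX x y xX yX xy) (sepX x z xX zX xz).
  rewrite [leqLHS](_ : n = (2 * q + 2 * (k * q))%N); last first.
    by rewrite -mulnDr -mulSn mulnA.
  rewrite leq_add2r => g2q.
  by rewrite [leqLHS](_ : n = (k.+1 * (2 * q))%N) ?leq_pmul2l// mulnCA mulnA.
have := acos_lt_pihalf kappa0 kle; rewrite min_r//.
move: angle_le; lra.
Qed.

Local Open Scope fset_scope.
Local Open Scope classical_set_scope.
Local Open Scope ring_scope.

(** * Passage to the growth rate and its left limit *)

Section GrowthRate.
Variable R : realType.

Lemma max_size_ge d (alpha : R) (X : {fset 'rV[R]_d}) :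
  angles_below alpha X -> ((#|` X|%:R)%:E <= max_size d alpha)%E.
Proof. by move=> aX; apply: ereal_sup_ubound; exists X. Qed.

Lemma max_size_ge0 d (alpha : R) : (0 <= max_size d alpha)%E.
Proof.
apply: (le_trans _ (@max_size_ge d alpha fset0 _)); first by rewrite cardfs0.
by move=> x y z; rewrite inE.
Qed.

Lemma max_size_le d (alpha beta : R) : alpha <= beta ->
  (max_size d alpha <= max_size d beta)%E.
Proof.
move=> ab; apply: ereal_sup_le => _ [X aX <-]; exists X => // x y z xX yX zX xy xz yz.
exact: lt_le_trans (aX x y z xX yX zX xy xz yz) ab.
Qed.

Lemma limn_esup_le (u v : nat -> \bar R) : (forall n, u n <= v n)%E ->
  (limn_esup u <= limn_esup v)%E.
Proof.
move=> uv; rewrite /limn_esup !limf_esupE; apply/ereal_infP => _ [V FV <-].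
apply: (@le_trans _ _ (ereal_sup (u @` V))%classic).
  by apply: ereal_inf_lbound; exists V.
apply: ge_ereal_sup => _ [n Vn <-]; apply: (le_trans (uv n)).
by apply: ereal_sup_ubound; exists n.
Qed.

Lemma limn_esup_ge (u : nat -> \bar R) (l : \bar R) :
  (\forall n \near \oo, l <= u n)%E -> (l <= limn_esup u)%E.
Proof.
move=> lu; rewrite /limn_esup limf_esupE; apply/ereal_infP => _ [V FV <-].
have [n [Vn lun]] : exists n, V n /\ (l <= u n)%E.
  by apply: (@filter_ex _ \oo%classic); apply: filterI.
by apply: (le_trans lun); apply: ereal_sup_ubound; exists n.
Qed.

Lemma growth_rate_le (alpha beta : R) : alpha <= beta ->
  (growth_rate alpha <= growth_rate beta)%E.
Proof.
move=> ab; apply: limn_esup_le => d; apply: gt0_ler_poweR.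
- by rewrite invr_ge0.
- by rewrite in_itv/= max_size_ge0 leey.
- by rewrite in_itv/= max_size_ge0 leey.
- exact: max_size_le.
Qed.

Lemma growth_rate_ge (alpha r : R) (N : nat) : 0 <= r ->
  (forall d, (N <= d)%N -> exists X : {fset 'rV[R]_d},
    r ^+ d <= #|` X|%:R /\ angles_below alpha X) ->
  (r%:E <= growth_rate alpha)%E.
Proof.
(* Starting at [N.+1] excludes [d = 0], where the root is a default value. *)
move=> r0 HN; apply: limn_esup_ge; exists N.+1 => // d /= Nd.
have d0 : (0 < d)%N by apply: leq_trans Nd.
have [X [rX aX]] := HN d (ltnW Nd).
have -> : r%:E = ((r ^+ d)%:E `^ (d%:R^-1))%E.
  by rewrite poweR_EFin -powR_mulrn// -powRrM divff ?powRr1// pnatr_eq0 -lt0n.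
apply: gt0_ler_poweR.
- by rewrite invr_ge0.
- by rewrite in_itv/= leey lee_fin exprn_ge0.
- by rewrite in_itv/= max_size_ge0 leey.
- by apply: le_trans (max_size_ge aX); rewrite lee_fin.
Qed.

(** Reflection in 0 reduces this to right limits of nonincreasing functions. *)
Lemma nondecreasing_cvg_at_left (f : R -> \bar R) (a : R) :
  {homo f : x y / x <= y >-> (x <= y)%E} -> cvg (f x @[x --> a^'-])%classic.
Proof.
move=> f_nd; apply/cvg_ex.
exists (ereal_sup [set (f \o -%R) x | x in [set` `](- a), +oo[%R]])%classic.
apply/cvg_at_leftNP; apply: nonincreasing_at_right_cvge => // x y _ _ xy.
by apply: f_nd; rewrite lerN2.
Qed.

End GrowthRate.

Theorem theorem1 (R : realType) :
  (cvg (growth_rate alpha @[alpha --> (pi / 2 : R)^'-]) /\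
   ((Num.sqrt 2 : R)%:E <=
     lim (growth_rate alpha @[alpha --> (pi / 2 : R)^'-]))%E) /\
  (forall eps : R, 0 < eps -> eps <= Num.sqrt 2 ->
    exists2 delta : R, 0 < delta &
      exists N : nat, forall d : nat, (N <= d)%N ->
        exists X : {fset 'rV[R]_d},
          (Num.sqrt 2 - eps) ^+ d <= #|` X|%:R /\
          angles_below (pi / 2 - delta) X).
Proof.
have gcvg : cvg (growth_rate alpha @[alpha --> (pi / 2 : R)^'-]).
  exact/nondecreasing_cvg_at_left/growth_rate_le.
split; last exact: large_angles_below.
split=> //; have s20 : 0 < Num.sqrt 2 :> R by rewrite sqrtr_gt0.
apply/lee_addgt0Pr => e e0; rewrite -leeBlDr//.
(* The construction requires [eps <= Num.sqrt 2]; a smaller [eps] only strengthens the bound. *)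
pose eps := Num.min e (Num.sqrt 2).
have eps0 : 0 < eps by rewrite lt_min e0.
have eps2 : eps <= Num.sqrt 2 by rewrite ge_min lexx orbT.
have [delta delta0 [N HN]] := large_angles_below eps0 eps2.
apply: (@le_trans _ _ (Num.sqrt 2 - eps)%:E).
  by rewrite -EFinB lee_fin lerB// ge_min lexx.
apply: lime_ge => //; near=> alpha.
have eps2' : 0 <= Num.sqrt 2 - eps by rewrite subr_ge0.
(* The bound at [pi / 2 - delta] carries over by monotonicity to every [alpha] between it and
   [pi / 2]. *)
apply: (le_trans (growth_rate_ge eps2' HN)).
apply: growth_rate_le; apply/ltW; near: alpha; apply: nbhs_left_gt.
by rewrite ltrBlDr ltrDl.
Unshelve. all: by end_near. Qed.
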